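(* Let $\mathcal Z\subset\mathbb R^d$ be nonempty, convex and compact, let $\alpha\in(0,1)$, and let $F:\mathcal Z\to\mathbb R^d$ be $\alpha$-Hölder continuous, i.e. $\|F(z)-F(z')\|_2\le H\|z-z'\|_2^{\alpha}$ for all $z,z'\in\mathcal Z$ and some $H>0$. Suppose there is a point $z^\star\in\mathcal Z$ with $\langle F(z),z-z^\star\rangle\ge0$ for all $z\in\mathcal Z$ (MVI property). Then after $O(m)$ iterations of optimistic gradient descent (OGD), with the learning rate specified in the context, there is an iterate that is an $m^{-\alpha/2}$-approximate strong solution to the variational inequality problem. That is, there is a constant $C>0$, independent of $m$, such that for every $m\in\mathbb N$, running OGD for $M:=\lceil Cm\rceil$ iterations with learning rate $\eta(M)$ produces an iterate $z^{(i)}$, $1\le i\le M$, satisfying $\langle z-z^{(i)},F(z^{(i)})\rangle\ge-m^{-\alpha/2}$ for all $z\in\mathcal Z$.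
   Context: OGD with predictions based on the secondary sequence, started at $z^{(0)}\in\mathcal Z$: $\hat z^{(0)}=z^{(0)}$ and, for $i\ge1$, $z^{(i)}=\mathrm{Proj}_{\mathcal Z}(\hat z^{(i-1)}-\eta F(\hat z^{(i-1)}))$, $\hat z^{(i)}=\mathrm{Proj}_{\mathcal Z}(\hat z^{(i-1)}-\eta F(z^{(i)}))$, with Euclidean projections. The learning rate for horizon $M$ is $$\eta(M):=\left(\frac{\|z^\star-z^{(0)}\|_2^2}{M\,H^{\frac{2}{1-\alpha}}\,g(\alpha)}\right)^{\frac{1-\alpha}{2}},\qquad g(\alpha)=(1+\alpha)(2+2\alpha)^{\frac{1-\alpha}{1+\alpha}},$$ where $z^\star$ is a point satisfying the MVI property; it is assumed that $\eta(M)>0$, i.e. $z^\star\ne z^{(0)}$. *)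

(* Defs.v *)
From mathcomp Require Import all_boot all_order all_algebra.
From mathcomp Require Import all_classical all_reals all_analysis.

Set Implicit Arguments.
Unset Strict Implicit.
Unset Printing Implicit Defensive.

Import Order.TTheory GRing.Theory Num.Theory.

Local Open Scope classical_set_scope.
Local Open Scope ring_scope.

(* The library norm `|u| on row vectors is the sup norm, so the Euclidean
   structure is introduced here; both norms induce the same topology. *)
Definition dotp (R : realType) (d : nat) (u v : 'rV[R]_d) : R :=
  \sum_(i < d) u ord0 i * v ord0 i.

Definition enorm (R : realType) (d : nat) (u : 'rV[R]_d) : R :=
  Num.sqrt (dotp u u).

(* Operators F : Z -> R^d are total functions; their values outside Z are
   never constrained nor used. *)
Definition holder_on (R : realType) (d : nat) (Z : set 'rV[R]_d) (H alpha : R)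
    (F : 'rV[R]_d -> 'rV[R]_d) : Prop :=
  forall z z', Z z -> Z z' ->
    enorm (F z - F z') <= H * enorm (z - z') `^ alpha.

Definition mvi_point (R : realType) (d : nat) (Z : set 'rV[R]_d)
    (F : 'rV[R]_d -> 'rV[R]_d) (zs : 'rV[R]_d) : Prop :=
  Z zs /\ forall z, Z z -> 0 <= dotp (F z) (z - zs).

Definition approx_strong_solution (R : realType) (d : nat) (Z : set 'rV[R]_d)
    (F : 'rV[R]_d -> 'rV[R]_d) (eps : R) (x : 'rV[R]_d) : Prop :=
  Z x /\ forall z, Z z -> - eps <= dotp (z - x) (F x).

Definition is_proj (R : realType) (d : nat) (Z : set 'rV[R]_d)
    (x p : 'rV[R]_d) : Prop :=
  Z p /\ forall z, Z z -> enorm (x - p) <= enorm (x - z).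

(* The default value x of xget is only returned when x has no nearest point in
   Z, which cannot happen for Z nonempty and compact; convexity of Z makes the
   nearest point unique. *)
Definition proj (R : realType) (d : nat) (Z : set 'rV[R]_d)
    (x : 'rV[R]_d) : 'rV[R]_d :=
  xget x (is_proj Z x).

(* One projected step from the secondary iterate w, along F evaluated at u. *)
Definition ogd_step (R : realType) (d : nat) (Z : set 'rV[R]_d)
    (F : 'rV[R]_d -> 'rV[R]_d) (eta : R) (w u : 'rV[R]_d) : 'rV[R]_d :=
  proj Z (w - eta *: F u).

(* ogd_secondary is the sequence \hat z^(i) and ogd is the sequence z^(i);
   z^(i) is inlined in the recursion since it depends only on \hat z^(i-1). *)
Fixpoint ogd_secondary (R : realType) (d : nat) (Z : set 'rV[R]_d)
    (F : 'rV[R]_d -> 'rV[R]_d) (eta : R) (z0 : 'rV[R]_d) (i : nat) : 'rV[R]_d :=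
  if i is j.+1 then
    let w := ogd_secondary Z F eta z0 j in
    ogd_step Z F eta w (ogd_step Z F eta w w)
  else z0.

Definition ogd (R : realType) (d : nat) (Z : set 'rV[R]_d)
    (F : 'rV[R]_d -> 'rV[R]_d) (eta : R) (z0 : 'rV[R]_d) (i : nat) : 'rV[R]_d :=
  if i is j.+1 then
    let w := ogd_secondary Z F eta z0 j in ogd_step Z F eta w w
  else z0.

Definition rate_const (R : realType) (alpha : R) : R :=
  (1 + alpha) * (2 + 2 * alpha) `^ ((1 - alpha) / (1 + alpha)).

Definition learning_rate (R : realType) (d : nat) (H alpha : R)
    (zs z0 : 'rV[R]_d) (M : nat) : R :=
  (enorm (zs - z0) ^+ 2 /
     (M%:R * H `^ (2 / (1 - alpha)) * rate_const alpha))
  `^ ((1 - alpha) / 2).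

(* Num.ceil is integer-valued; `|_|%N is used only for 0 <= C * m, where the
   ceiling is nonnegative and it is the identity. *)
Definition horizon (R : realType) (C : R) (m : nat) : nat :=
  `|Num.ceil (C * m%:R)|%N.

(* Main.v *)
Require Import Defs.
From mathcomp Require Import all_boot all_order all_algebra.
From mathcomp Require Import all_classical all_reals all_analysis.
From mathcomp Require Import ring lra.

Import numFieldNormedType.Exports.
Import Order.TTheory GRing.Theory Num.Theory.

Local Open Scope classical_set_scope.
Local Open Scope ring_scope.

(** With w = \hat z^(i) and u = z^(i+1), one step satisfies
      |\hat z^(i+1) - z*|^2
        <= |w - z*|^2 - |w - u|^2 + eta^2 H^2 |w - u|^(2 alpha).
    Put r = kappa / sqrt M.  Since eta(M) is proportional to
    M^(-(1-alpha)/2), for kappa large the last term is at most half of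
    |w - u|^2 whenever |w - u| >= r, so M steps with |w - u| > r would decrease
    the squared distance to z* by more than its initial value.  Hence some
    step has |w - u| <= r, and the variational characterization of u then gives
      <z - u, F u> >= - diam Z (r / eta + H r^alpha),
    where both r / eta and r^alpha are of order M^(-alpha/2). *)

(** * Euclidean inner product and norm *)

Section Dot.
Context {R : realType} {d : nat}.
Implicit Types (u v w x y z : 'rV[R]_d).

Lemma dotpC u v : dotp u v = dotp v u.
Proof. by apply: eq_bigr => i _; rewrite mulrC. Qed.

Lemma dotpDl u v w : dotp (u + v) w = dotp u w + dotp v w.
Proof. by rewrite -big_split; apply: eq_bigr => i _; rewrite mxE mulrDl. Qed.

Lemma dotpZl a u v : dotp (a *: u) v = a * dotp u v.
Proof. by rewrite mulr_sumr; apply: eq_bigr => i _; rewrite mxE mulrA. Qed.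

Lemma dotpNl u v : dotp (- u) v = - dotp u v.
Proof. by rewrite -scaleN1r dotpZl mulN1r. Qed.

Lemma dotpDr u v w : dotp u (v + w) = dotp u v + dotp u w.
Proof. by rewrite dotpC dotpDl !(dotpC _ u). Qed.

Lemma dotpZr a u v : dotp u (a *: v) = a * dotp u v.
Proof. by rewrite dotpC dotpZl dotpC. Qed.

Lemma dotpNr u v : dotp u (- v) = - dotp u v.
Proof. by rewrite dotpC dotpNl dotpC. Qed.

Definition dotpE := (dotpDl, dotpDr, dotpNl, dotpNr, dotpZl, dotpZr).

Lemma dotp_ge0 u : 0 <= dotp u u.
Proof. by apply: sumr_ge0 => i _; rewrite -expr2 sqr_ge0. Qed.

Lemma dotp_eq0 u : dotp u u = 0 -> u = 0.
Proof.
move=> /eqP; rewrite psumr_eq0 => [/allP u0|i _]; last by rewrite -expr2 sqr_ge0.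
apply/rowP => i; rewrite mxE.
by have := u0 i (mem_index_enum i); rewrite /= mulf_eq0 orbb => /eqP.
Qed.

Lemma enorm_ge0 u : 0 <= enorm u.
Proof. exact: sqrtr_ge0. Qed.

Lemma sqr_enorm u : enorm u ^+ 2 = dotp u u.
Proof. exact/sqr_sqrtr/dotp_ge0. Qed.

Lemma enorm_gt0 u : u <> 0 -> 0 < enorm u.
Proof.
move=> u0; rewrite lt_neqAle enorm_ge0 andbT eq_sym; apply/eqP => nu0.
by apply/u0/dotp_eq0; rewrite -sqr_enorm nu0 expr0n.
Qed.

Lemma enormN u : enorm (- u) = enorm u.
Proof. by rewrite /enorm !dotpE opprK. Qed.

Lemma enorm_distC u v : enorm (u - v) = enorm (v - u).
Proof. by rewrite -enormN opprB. Qed.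

Lemma CauchySchwarz_dotp u v : dotp u v <= enorm u * enorm v.
Proof.
have [->|/eqP v0] := eqVneq v 0.
  by rewrite -(scale0r 0) dotpZr mul0r mulr_ge0 ?enorm_ge0.
have b0 : 0 < dotp v v by rewrite -sqr_enorm exprn_gt0 ?enorm_gt0.
(* This vector is [dotp v v] times the component of [u] orthogonal to [v]; its squared norm has the
   factor [dotp v v], which is then cancelled. *)
have := dotp_ge0 (dotp v v *: u - dotp u v *: v).
rewrite !dotpE (dotpC v u) => pos.
have {}pos : 0 <= dotp v v * (dotp u u * dotp v v - dotp u v ^+ 2) by lra.
rewrite pmulr_rge0 // subr_ge0 in pos.
apply: le_trans (ler_norm _) _.
rewrite -(@ler_pXn2r _ 2) ?nnegrE ?mulr_ge0 ?enorm_ge0 ?normr_ge0 //.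
by rewrite exprMn !sqr_enorm real_normK ?num_real.
Qed.

Lemma ler_enormD u v : enorm (u + v) <= enorm u + enorm v.
Proof.
rewrite -(@ler_pXn2r _ 2) ?nnegrE ?addr_ge0 ?enorm_ge0 //.
rewrite sqr_enorm sqrrD !sqr_enorm !dotpE (dotpC v u).
have := CauchySchwarz_dotp u v; lra.
Qed.

(** * Nearest points and the diameter of a compact set *)

Lemma enorm_continuous x : continuous (fun z => enorm (x - z)).
Proof.
have cdotp : continuous (fun z => dotp (x - z) (x - z)).
  apply: continuous_big => [|i _]; first exact: add_continuous.
  have cz : continuous (fun z : 'rV[R]_d => (x - z) ord0 i).
    move=> z.
    apply: (@continuous_comp _ _ _ (fun z' => x - z') (fun y => y ord0 i)).
      by apply: continuousB; [exact: cst_continuous|exact: cvg_id].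
    exact: coord_continuous.
  by move=> z; apply: continuousM; exact: cz.
move=> z.
apply: (@continuous_comp _ _ _ (fun z => dotp (x - z) (x - z)) Num.sqrt).
  exact: cdotp.
exact: sqrt_continuous.
Qed.

Lemma is_proj_exists {Z : set 'rV[R]_d} x :
  Z !=set0 -> compact Z -> exists p, is_proj Z x p.
Proof.
move=> Z0 cZ.
have [|p /set_mem Zp pmin] := @EVT_min_rV _ _ (fun z => enorm (x - z)) Z Z0 cZ.
  exact/continuous_subspaceT/enorm_continuous.
by exists p; split=> // z Zz; apply: pmin; rewrite inE.
Qed.

Lemma proj_is_proj {Z : set 'rV[R]_d} x :
  Z !=set0 -> compact Z -> is_proj Z x (Defs.proj Z x).
Proof. by move=> Z0 cZ; apply: xgetPex; exact: is_proj_exists. Qed.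

Lemma is_proj_obtuse {Z : set 'rV[R]_d} x p z :
  convex_set Z -> is_proj Z x p -> Z z -> dotp (x - p) (z - p) <= 0.
Proof.
move=> cvxZ [Zp pmin] Zz; rewrite leNgt; apply/negP => c0.
set c := dotp _ _ in c0; set q := dotp (z - p) (z - p).
have q0 : 0 <= q := dotp_ge0 _.
(* Moving from [p] towards [z] by [t] changes the squared distance to [x] by [t * (t * q - 2 * c)].
   This [t] lies in [(0, 1]], even if [q = 0], and has [t * q < c], so the distance drops. *)
pose t := c / (q + c).
have t0 : 0 <= t by rewrite divr_ge0 ?addr_ge0 ?(ltW c0).
have t1 : t <= 1 by rewrite ler_pdivrMr; lra.
have te : t * (q + c) = c by rewrite divfK //; lra.
have /set_mem := cvxZ z p (Itv01 t0 t1) (mem_set Zz) (mem_set Zp).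
rewrite /conv /= => /pmin.
rewrite -(@ler_pXn2r _ 2) ?nnegrE ?enorm_ge0 // !sqr_enorm.
have -> : x - (t *: z + (1 - t) *: p) = (x - p) - t *: (z - p).
  by apply/rowP => i; rewrite !mxE; ring.
have -> : dotp (x - p - t *: (z - p)) (x - p - t *: (z - p))
   = dotp (x - p) (x - p) - 2 * t * c + t ^+ 2 * q.
  move: @c @q {c0 q0 t0 t1 te} t => /= t.
  move: (x - p) (z - p) => a b; rewrite !dotpE (dotpC b a); ring.
have : 0 < t by rewrite divr_gt0 //; lra.
nra.
Qed.

Lemma compact_diameter {Z : set 'rV[R]_d} :
  Z !=set0 -> compact Z ->
  exists2 B, 0 < B & forall x y, Z x -> Z y -> enorm (x - y) <= B.
Proof.
move=> Z0 cZ; have [z0 _] := Z0.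
have [|p _ pmax] := @EVT_max_rV _ _ (fun z => enorm (z0 - z)) Z Z0 cZ.
  exact/continuous_subspaceT/enorm_continuous.
(* [p] is farthest from [z0] in [Z]; the [+ 1] keeps the bound positive when [Z] is a single
   point. *)
exists (2 * enorm (z0 - p) + 1) => [|x y Zx Zy].
  by have := enorm_ge0 (z0 - p); lra.
have := ler_enormD (x - z0) (z0 - y).
rewrite addrA subrK (enorm_distC x z0).
by have := pmax x (mem_set Zx); have := pmax y (mem_set Zy); lra.
Qed.

(* With f0 = F w and f1 = F u: the two obtuse angle inequalities combine, and
   the cross term is absorbed by
   2<eta(f0 - f1), w' - u> <= eta^2|f0 - f1|^2 + |w' - u|^2. *)
Lemma extragradient_descent {eta : R} {w u w' f0 f1 s} :
  0 <= eta ->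
  dotp (w - eta *: f0 - u) (w' - u) <= 0 ->
  dotp (w - eta *: f1 - w') (s - w') <= 0 ->
  0 <= dotp f1 (u - s) ->
  dotp (w' - s) (w' - s) <=
  dotp (w - s) (w - s) - dotp (w - u) (w - u)
    + eta ^+ 2 * dotp (f1 - f0) (f1 - f0).
Proof.
move=> eta0 h0 h1 /(mulr_ge0 eta0).
have := dotp_ge0 (eta *: (f0 - f1) - (w' - u)).
move: h0 h1; rewrite !dotpE.
(* Each mixed product gets one fixed orientation, so that the goal becomes linear in them. *)
rewrite ?(dotpC w' w) ?(dotpC u w) ?(dotpC s w) ?(dotpC u w') ?(dotpC s w').
rewrite ?(dotpC s u) ?(dotpC w f0) ?(dotpC w f1) ?(dotpC u f0) ?(dotpC u f1).
rewrite ?(dotpC w' f0) ?(dotpC w' f1) ?(dotpC s f0) ?(dotpC s f1).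
rewrite ?(dotpC f1 f0).
lra.
Qed.

End Dot.

(** * Descent and gap along the OGD iterates *)

Section Ogd.
Context {R : realType} {d : nat} {Z : set 'rV[R]_d} {alpha H : R}.
Context {F : 'rV[R]_d -> 'rV[R]_d} {zs z0 : 'rV[R]_d}.
Hypotheses (Z_convex : convex_set Z) (Z_compact : compact Z).
Hypotheses (alpha_gt0 : 0 < alpha) (alpha_lt1 : alpha < 1) (H_gt0 : 0 < H).
Hypothesis F_holder : holder_on Z H alpha F.
Hypotheses (zs_mvi : mvi_point Z F zs) (z0_in : Z z0).

Let Z_nonempty : Z !=set0. Proof. by exists z0. Qed.

Lemma ogd_step_proj eta w u : is_proj Z (w - eta *: F u) (ogd_step Z F eta w u).
Proof. exact: proj_is_proj. Qed.

Lemma ogd_step_in eta w u : Z (ogd_step Z F eta w u).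
Proof. by have [] := ogd_step_proj eta w u. Qed.

Lemma ogd_secondary_in eta i : Z (ogd_secondary Z F eta z0 i).
Proof. by case: i => //= i; exact: ogd_step_in. Qed.

Lemma sqr_holder_le_half {eta r a : R} :
  0 < r -> r <= a -> eta ^+ 2 * H ^+ 2 <= r `^ (2 * (1 - alpha)) / 2 ->
  eta ^+ 2 * (H * a `^ alpha) ^+ 2 <= a ^+ 2 / 2.
Proof.
move=> r0 ra hr; have a0 : 0 < a by lra.
have ha : eta ^+ 2 * H ^+ 2 <= a `^ (2 * (1 - alpha)) / 2.
  apply: le_trans hr _; rewrite ler_pM2r ?invr_gt0 //.
  apply: ge0_ler_powR; rewrite ?nnegrE ?(ltW r0) ?(ltW a0) //.
  by move: alpha_lt1; lra.
have -> : a ^+ 2 / 2 = a `^ (2 * (1 - alpha)) / 2 * (a `^ alpha) ^+ 2.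
  rewrite [RHS]mulrAC -!powR_mulrn ?powR_ge0 ?(ltW a0) // -powRrM -powRD.
    by congr (_ `^ _ / _); ring.
  by rewrite (gt_eqF a0) implybT.
by rewrite exprMn mulrA ler_wpM2r ?sqr_ge0.
Qed.

(** The MVI property at the primary iterate enables [extragradient_descent]; the Hölder error uses
    up half of the gain [|w - u|^2], and the other half is at least [r ^+ 2 / 2]. *)
Lemma ogd_secondary_descent {eta r : R} {i} :
  let w := ogd_secondary Z F eta z0 i in
  let w' := ogd_secondary Z F eta z0 i.+1 in
  0 <= eta -> 0 < r -> eta ^+ 2 * H ^+ 2 <= r `^ (2 * (1 - alpha)) / 2 ->
  r <= enorm (w - ogd Z F eta z0 i.+1) ->
  enorm (w' - zs) ^+ 2 <= enorm (w - zs) ^+ 2 - r ^+ 2 / 2.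
Proof.
move=> w w' eta0 r0 hr ra; set u := ogd _ _ _ _ _ in ra.
have Zw : Z w by exact: ogd_secondary_in.
have Zu : Z u by exact: ogd_step_in.
have Zw' : Z w' by exact: ogd_secondary_in.
have [Zzs mvi] := zs_mvi.
have h0 : dotp (w - eta *: F w - u) (w' - u) <= 0.
  exact: is_proj_obtuse Z_convex (ogd_step_proj _ _ _) Zw'.
have h1 : dotp (w - eta *: F u - w') (zs - w') <= 0.
  exact: is_proj_obtuse Z_convex (ogd_step_proj _ _ _) Zzs.
have := extragradient_descent eta0 h0 h1 (mvi u Zu).
have hF : dotp (F u - F w) (F u - F w) <= (H * enorm (w - u) `^ alpha) ^+ 2.
  rewrite -sqr_enorm ler_pXn2r ?nnegrE ?enorm_ge0 ?mulr_ge0 ?powR_ge0 //;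
    last exact: ltW.
  by rewrite (enorm_distC w u); exact: F_holder.
have := sqr_holder_le_half r0 ra hr.
have := ler_wpM2l (sqr_ge0 eta) hF.
have : r ^+ 2 <= enorm (w - u) ^+ 2.
  by rewrite ler_pXn2r ?nnegrE ?enorm_ge0 ?(ltW r0).
rewrite !sqr_enorm; clearbody w w' u; lra.
Qed.

(* Otherwise every step would decrease the squared distance to zs by r^2/2,
   which exceeds the initial distance after M steps. *)
Lemma ogd_small_step {eta r : R} {M} :
  0 <= eta -> 0 < r -> eta ^+ 2 * H ^+ 2 <= r `^ (2 * (1 - alpha)) / 2 ->
  enorm (z0 - zs) ^+ 2 < M%:R * (r ^+ 2 / 2) ->
  exists2 i, (i < M)%N &
    enorm (ogd_secondary Z F eta z0 i - ogd Z F eta z0 i.+1) <= r.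
Proof.
move=> eta0 r0 hr hM; apply: contrapT => nex.
have big i : (i < M)%N ->
    r <= enorm (ogd_secondary Z F eta z0 i - ogd Z F eta z0 i.+1).
  by move=> iM; rewrite leNgt; apply/negP => /ltW le_r; apply: nex; exists i.
have tele n : (n <= M)%N -> enorm (ogd_secondary Z F eta z0 n - zs) ^+ 2 <=
    enorm (z0 - zs) ^+ 2 - n%:R * (r ^+ 2 / 2).
  elim: n => [|n IHn] nM; first by rewrite mul0r subr0.
  have := ogd_secondary_descent eta0 r0 hr (big n nM).
  have := IHn (ltnW nM); rewrite -natr1; lra.
have := tele M (leqnn M).
have := sqr_ge0 (enorm (ogd_secondary Z F eta z0 M - zs)); lra.
Qed.

Lemma ogd_strong_gap {eta B r : R} {i} {z} :
  (forall x y, Z x -> Z y -> enorm (x - y) <= B) -> 0 < eta ->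
  enorm (ogd_secondary Z F eta z0 i - ogd Z F eta z0 i.+1) <= r -> Z z ->
  - (B * (r / eta + H * r `^ alpha)) <=
    dotp (z - ogd Z F eta z0 i.+1) (F (ogd Z F eta z0 i.+1)).
Proof.
move=> diam eta0; set w := ogd_secondary _ _ _ _ _; set u := ogd _ _ _ _ _.
move=> le_r Zz.
have Zw : Z w by exact: ogd_secondary_in.
have Zu : Z u by exact: ogd_step_in.
have B0 : 0 <= B by apply: le_trans (diam _ _ Zw Zu); exact: enorm_ge0.
have r0 : 0 <= r by apply: le_trans le_r; exact: enorm_ge0.
have h0 : dotp (w - eta *: F w - u) (z - u) <= 0.
  exact: is_proj_obtuse Z_convex (ogd_step_proj _ _ _) Zz.
have zuB : enorm (z - u) <= B by exact: diam.
have hF : enorm (F w - F u) <= H * r `^ alpha.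
  apply: le_trans (F_holder _ _ Zw Zu) _.
  rewrite ler_pM2l //.
  by apply: ge0_ler_powR; rewrite ?nnegrE ?enorm_ge0 ?(ltW alpha_gt0).
have cF : dotp (F w - F u) (z - u) <= B * (H * r `^ alpha).
  apply: le_trans (CauchySchwarz_dotp _ _) _.
  by rewrite mulrC ler_pM ?enorm_ge0.
have cw : dotp (u - w) (z - u) <= B * r.
  apply: le_trans (CauchySchwarz_dotp _ _) _.
  by rewrite mulrC enorm_distC ler_pM ?enorm_ge0 // enorm_distC.
rewrite -(ler_pM2l eta0).
have -> : eta * - (B * (r / eta + H * r `^ alpha)) =
    - (B * r) - eta * (B * (H * r `^ alpha)).
  by field; rewrite gt_eqF.
have := ler_wpM2l (ltW eta0) cF.
rewrite (dotpC _ (F u)).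
move: h0 cw; rewrite !dotpE; lra.
Qed.

End Ogd.

(** Isolates the dependence on the horizon: since [e] is the same for all [M], the constant [C] can
    be built from it without circularity. *)
Lemma learning_rateE {R : realType} {d : nat} {H alpha : R} {zs z0 : 'rV[R]_d} :
  0 < alpha -> alpha < 1 -> 0 < H -> zs <> z0 ->
  exists2 e : R, 0 < e & forall M, (0 < M)%N ->
    learning_rate H alpha zs z0 M = e * M%:R `^ (- ((1 - alpha) / 2)).
Proof.
move=> a0 a1 H0 zsz0.
have D0 : 0 < enorm (zs - z0).
  by apply: enorm_gt0 => /subr0_eq.
have g0 : 0 < rate_const alpha by rewrite /rate_const mulr_gt0 ?powR_gt0 //; lra.
have h0 : 0 < H `^ (2 / (1 - alpha)) by rewrite powR_gt0.
pose c := enorm (zs - z0) ^+ 2 / (H `^ (2 / (1 - alpha)) * rate_const alpha).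
have c0 : 0 < c by apply: divr_gt0; [rewrite exprn_gt0|rewrite mulr_gt0].
exists (c `^ ((1 - alpha) / 2)) => [|M M0]; first by rewrite powR_gt0.
have M0' : 0 < M%:R :> R by rewrite ltr0n.
rewrite /learning_rate.
have -> : enorm (zs - z0) ^+ 2 /
    (M%:R * H `^ (2 / (1 - alpha)) * rate_const alpha) = c / M%:R.
  by rewrite /c; field; rewrite !gt_eqF.
rewrite powRN powRM ?invr_ge0 ?(ltW c0) ?(ltW M0') //.
by rewrite -(powR_inv1 (ltW M0')) -powRrM mulN1r powRN.
Qed.

(** * Choice of the radius and of the horizon constant *)

Theorem theoremC34 (R : realType) (d : nat) (Z : set 'rV[R]_d)
    (alpha H : R) (F : 'rV[R]_d -> 'rV[R]_d) (zs z0 : 'rV[R]_d)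
    (Z_nonempty : Z !=set0) (Z_convex : convex_set Z) (Z_compact : compact Z)
    (alpha_gt0 : 0 < alpha) (alpha_lt1 : alpha < 1)
    (H_gt0 : 0 < H) (F_holder : holder_on Z H alpha F)
    (zs_mvi : mvi_point Z F zs)
    (z0_in : Z z0) (zs_neq_z0 : zs <> z0) :
  exists2 C : R, 0 < C &
    forall m : nat, (0 < m)%N ->
      let M := horizon C m in
      exists2 i : nat, (1 <= i <= M)%N &
        approx_strong_solution Z F (m%:R `^ (- (alpha / 2)))
          (ogd Z F (learning_rate H alpha zs z0 M) z0 i).
Proof.
have [e e0 etaE] := learning_rateE alpha_gt0 alpha_lt1 H_gt0 zs_neq_z0.
have [B B0 diam] := compact_diameter Z_nonempty Z_compact.
have D0 : 0 < enorm (z0 - zs).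
  by apply: enorm_gt0 => /subr0_eq/esym.
(* kappa is chosen so that the radius r = kappa / sqrt M meets both
   hypotheses of ogd_small_step when eta = e M^(-(1-alpha)/2). *)
pose kappa := (2 * (e * H) ^+ 2) `^ (2 * (1 - alpha))^-1 + 2 * enorm (z0 - zs).
have k0 : 0 < kappa by rewrite ltr_wpDl ?powR_ge0 // mulr_gt0.
(* The first summand of [kappa] alone gives equality here. *)
have ka : (e * H) ^+ 2 <= kappa `^ (2 * (1 - alpha)) / 2.
  rewrite ler_pdivlMr // mulrC.
  have p0 : 2 * (1 - alpha) != 0 by apply: lt0r_neq0; lra.
  have eH0 : 0 <= 2 * (e * H) ^+ 2 by rewrite mulr_ge0 // sqr_ge0.
  rewrite -[leLHS]powRr1 // -[X in _ `^ X <= _](mulVf p0) powRrM.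
  apply: ge0_ler_powR; rewrite ?nnegrE ?powR_ge0 ?(ltW k0) //; first by lra.
  by rewrite lerDl; lra.
pose K := B * (kappa / e + H * kappa `^ alpha).
have K0 : 0 < K by rewrite mulr_gt0 // addr_gt0 ?divr_gt0 ?mulr_gt0 ?powR_gt0.
exists (K `^ (2 / alpha)) => [|m m0 M]; first by rewrite powR_gt0.
have m0' : 0 < m%:R :> R by rewrite ltr0n.
have Cm0 : 0 < K `^ (2 / alpha) * m%:R by rewrite mulr_gt0 ?powR_gt0.
have CmM : K `^ (2 / alpha) * m%:R <= M%:R.
  rewrite /M /horizon natr_absz ger0_norm ?ceil_ge //.
  by rewrite ceil_ge0 (lt_trans _ Cm0) // ltrN10.
have M0' : 0 < M%:R :> R by exact: lt_le_trans CmM.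
have M0 : (0 < M)%N by rewrite -(ltr0n R).
have eta0 : 0 < learning_rate H alpha zs z0 M.
  by rewrite etaE // mulr_gt0 ?powR_gt0.
pose r := kappa * M%:R `^ (- 2^-1).
have r0 : 0 < r by rewrite mulr_gt0 ?powR_gt0.
have powM s t : M%:R `^ s * M%:R `^ t = M%:R `^ (s + t) :> R.
  by rewrite powRD // (gt_eqF M0') implybT.
have r2 : M%:R * r ^+ 2 = kappa ^+ 2.
  rewrite exprMn mulrCA -[X in _ * (X * _)]powRr1 ?(ltW M0') //.
  rewrite -(@powR_mulrn _ (_ `^ _) 2) ?powR_ge0 // -powRrM powM.
  by rewrite (_ : 1 + _ = 0) ?powRr0 ?mulr1 //; field.
have hr : learning_rate H alpha zs z0 M ^+ 2 * H ^+ 2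
    <= r `^ (2 * (1 - alpha)) / 2.
  (* Both sides carry the same power [- (1 - alpha)] of [M], which leaves [ka]. *)
  rewrite etaE // /r powRM ?powR_ge0 ?(ltW k0) // -powRrM.
  rewrite -exprMn mulrAC exprMn -(@powR_mulrn _ (_ `^ _) 2) ?powR_ge0 // -powRrM.
  rewrite (_ : - ((1 - alpha) / 2) * 2 = - 2^-1 * (2 * (1 - alpha)));
    last by field.
  by rewrite [leRHS]mulrAC ler_pM2r ?powR_gt0.
have hM : enorm (z0 - zs) ^+ 2 < M%:R * (r ^+ 2 / 2).
  (* The second summand of [kappa] gives [kappa ^+ 2 / 2 >= 2 * enorm (z0 - zs) ^+ 2]; strictness
     comes from [D0]. *)
  rewrite mulrA r2.
  have : (2 * enorm (z0 - zs)) ^+ 2 <= kappa ^+ 2.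
    rewrite ler_pXn2r ?nnegrE ?(ltW k0) ?mulr_ge0 ?enorm_ge0 //.
    by rewrite lerDr powR_ge0.
  have : 0 < enorm (z0 - zs) ^+ 2 by rewrite exprn_gt0.
  rewrite exprMn; lra.
have [i iM small] := ogd_small_step Z_convex Z_compact alpha_lt1 H_gt0
  F_holder zs_mvi z0_in (ltW eta0) r0 hr hM.
(* The small step at [i < M] leads to the iterate of index [i.+1], which is in [1..M]. *)
exists i.+1 => //; split; first exact: (ogd_step_in Z_compact z0_in).
move=> z Zz; apply: le_trans (ogd_strong_gap Z_convex Z_compact alpha_gt0
  H_gt0 F_holder z0_in diam eta0 small Zz).
rewrite lerN2.
have -> : B * (r / learning_rate H alpha zs z0 M + H * r `^ alpha) =
    K * M%:R `^ (- (alpha / 2)).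
  rewrite etaE // /r /K powRM ?powR_ge0 ?(ltW k0) // -powRrM.
  rewrite (_ : - 2^-1 * alpha = - (alpha / 2)); last by field.
  (* The first part of the exponent cancels against the learning rate in [r / eta]. *)
  rewrite (_ : - 2^-1 = - ((1 - alpha) / 2) + - (alpha / 2)); last by field.
  rewrite -powM; field; rewrite !gt_eqF ?powR_gt0 //.
rewrite [in leRHS]powRN powRN ler_pdivrMr ?powR_gt0 //.
rewrite ler_pdivlMl ?powR_gt0 //.
apply: le_trans (_ : (K `^ (2 / alpha) * m%:R) `^ (alpha / 2) <= _).
  rewrite powRM ?powR_ge0 ?(ltW m0') // -powRrM.
  rewrite (_ : 2 / alpha * (alpha / 2) = 1) ?powRr1 ?(ltW K0) 1?mulrC //.
  by field; rewrite gt_eqF.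
apply: ge0_ler_powR; rewrite ?nnegrE ?(ltW Cm0) ?(ltW M0') //.
by rewrite divr_ge0 // ltW.
Qed.
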